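(* Let $M,L,G>0$ and $\alpha\ge0$. Suppose that every cost function $f_t:[0,1]\to[0,\infty)$, $1\le t\le T$, is convex, $M$-smooth, $L$-Lipschitz and satisfies $\min_{x\in[0,1]}f_t(x)=0$. Consider the noisy fresh gradient setting with error at most $\alpha$, write $\nabla_t:=\nabla f_t(x_{t-1})$ and let $\nabla_t^{avl}$ be the received gradient, so $|\nabla_t^{avl}-\nabla_t|\le\alpha$; assume moreover that $|\nabla_t^{avl}|\le G$ and $\alpha<|\nabla_t|$ for all $t$. Run the algorithm A-OBD$(\delta_t)$ with $$\delta_t=G+L-|\nabla_t^{avl}| .$$ Then its competitive ratio satisfies $$\mu_{\text{A-OBD}(\delta_t)}\le\max\left\{1+\frac{2+\hat b}{\hat a},\ 1+\hat b\right\}=O(M+L+\alpha^2),$$ where $$\hat a=\left(L-\frac{\alpha L}{G+L-2\alpha}\right)\left(1-\frac{\alpha}{G+L-\alpha}\right),\qquad \hat b=\left(G+L+\frac M2+\frac{\alpha L}{G+L}\right)\left(1+\frac{\alpha}{G+L-\alpha}\right).$$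
   Context: Problem (online convex optimization with linear switching cost, dimension one). An input $\sigma$ consists of a horizon $T$, a starting point $x_0\in[0,1]$, cost functions $f_1,\dots,f_T:[0,1]\to[0,\infty)$ and (here) the gradient noise. Choosing actions $x_1,\dots,x_T\in[0,1]$ costs $\sum_{t=1}^T\big(f_t(x_t)+|x_t-x_{t-1}|\big)$. $C_{\mathcal A}(\sigma)$ is the cost of the online algorithm $\mathcal A$ on $\sigma$, and $C_{OPT}(\sigma)$ is the minimum of the cost over all action sequences in $[0,1]$ with the same starting point $x_0$ (the whole input being known in advance). The competitive ratio is $\mu_{\mathcal A}=\max_\sigma C_{\mathcal A}(\sigma)/C_{OPT}(\sigma)$, over all inputs satisfying the stated assumptions; $\mu_{\mathcal A}\le c$ means $C_{\mathcal A}(\sigma)\le c\,C_{OPT}(\sigma)$ for every such $\sigma$. Smoothness: $f$ is $M$-smooth if it is differentiable on $[0,1]$ (one-sidedly at the endpoints) with $M$-Lipschitz derivative $\nabla f$. Noisy fresh gradient setting: at time $t$, before choosing $x_t$, the algorithm receives the exact value $f_t(x_{t-1})$ and a number $\nabla_t^{avl}$ with $|\nabla_t^{avl}-\nabla f_t(x_{t-1})|\le\alpha$; it may use all information received at times $1,\dots,t$. The value $\alpha$ is not used by the algorithm. Algorithm A-OBD$(\delta_t)$, in the noisy fresh gradient setting: at each time $t$, let $L_1(x)=f_t(x_{t-1})+\nabla_t^{avl}(x-x_{t-1})$ and $L_2(x)=\delta_t\cdot\operatorname{sign}(-\nabla_t^{avl})\,(x-x_{t-1})$, and let $x_t$ be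 the point with $L_1(x_t)=L_2(x_t)$.
   Formalization: The bound is stated only for â > 0 (it can fail when â < 0 and â is undefined at G+L = 2α); the O(M+L+α²) claim is for fixed G and â bounded below by a fixed positive constant, with α < L, since it fails as â → 0 or G → ∞. *)

(* Defs.v *)
From HB Require Import structures.
From mathcomp Require Import all_boot all_order all_algebra.
From mathcomp Require Import all_classical all_reals all_analysis.

Set Implicit Arguments.
Unset Strict Implicit.
Unset Printing Implicit Defensive.

Import Order.TTheory GRing.Theory Num.Theory.
Import numFieldNormedType.Exports.

Local Open Scope classical_set_scope.
Local Open Scope ring_scope.

Definition I01 (R : realType) : set R := `[0, 1]%classic.
Arguments I01 R : clear implicits.

(* A function on [0,1] is represented by a total function R -> R of which only
   the values on [0,1] matter.  Points y != x are restricted to [0,1], so that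
   the limit as y tends to x is the derivative relative to [0,1]: two-sided
   inside, one-sided at the endpoints. *)
Definition slopes (R : realType) (f : R -> R) (x : R) : set_system R :=
  (fun y => (f y - f x) / (y - x)) @ within (I01 R) x^'.

Definition differentiable01 (R : realType) (f : R -> R) : Prop :=
  forall x, I01 R x -> cvg (slopes f x).

Definition grad (R : realType) (f : R -> R) (x : R) : R := lim (slopes f x).

Definition smooth (R : realType) (M : R) (f : R -> R) : Prop :=
  differentiable01 f /\ M.-lipschitz_(I01 R) (grad f).

Definition min_zero (R : realType) (f : R -> R) : Prop :=
  (forall x, I01 R x -> 0 <= f x) /\ (exists x, I01 R x /\ f x = 0).

(* Rounds are numbered 1, ..., horizon; the values of cost and noise at other
   indices are irrelevant. *)
Record input (R : realType) := Input {
  horizon : nat;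
  start : R;
  cost : nat -> R -> R;
  noise : nat -> R }.

Definition total_cost (R : realType) (s : input R) (x : nat -> R) : R :=
  \sum_(1 <= t < (horizon s).+1) (cost s t (x t) + `|x t - x t.-1|).

Definition feasible (R : realType) (s : input R) (x : nat -> R) : Prop :=
  x 0%N = start s /\ forall t, (1 <= t <= horizon s)%N -> I01 R (x t).

Definition opt_cost (R : realType) (s : input R) : R :=
  inf [set total_cost s x | x in feasible s].

(* What is received in one round t: the pair (f_t(x_{t-1}), received gradient).
   Histories are listed most recent round first. *)
Definition observation (R : realType) : Type := (R * R)%type.

(* The action of a round is computed from the starting point and from the
   history, the observation of the current round included. *)
Definition algorithm (R : realType) : Type := R -> seq (observation R) -> R.

(* The action x_t together with the history of rounds 1, ..., t. *)
Fixpoint run (R : realType) (A : algorithm R) (s : input R) (t : nat) :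
    R * seq (observation R) :=
  if t is t'.+1 then
    let: (x, h) := run A s t' in
    let h' := (cost s t x, grad (cost s t) x + noise s t) :: h in
    (A (start s) h', h')
  else (start s, [::]).

Definition action (R : realType) (A : algorithm R) (s : input R) (t : nat) : R :=
  (run A s t).1.

Definition true_grad (R : realType) (A : algorithm R) (s : input R) (t : nat) : R :=
  grad (cost s t) (action A s t.-1).

Definition avl_grad (R : realType) (A : algorithm R) (s : input R) (t : nat) : R :=
  true_grad A s t + noise s t.

(* "The competitive ratio of A over the inputs in S is at most c".  An algorithm
   whose actions leave [0,1] on some input of S has no competitive ratio. *)
Definition competitive_ratio_le (R : realType) (A : algorithm R)
    (S : set (input R)) (c : R) : Prop :=
  forall s, S s ->
    feasible s (action A s) /\ total_cost s (action A s) <= c * opt_cost s.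

(* The set of points y in which xget chooses is a singleton as soon as the
   received gradient g is nonzero and 0 <= delta g. *)
Definition A_OBD_step (R : realType) (delta : R -> R) (o : observation R) (x : R) : R :=
  let: (v, g) := o in
  let L1 := fun y => v + g * (y - x) in
  let L2 := fun y => delta g * Num.sg (- g) * (y - x) in
  xget x [set y | L1 y = L2 y].

(* The parameter delta_t is a function of the gradient received in round t. *)
Definition A_OBD (R : realType) (delta : R -> R) : algorithm R :=
  fun x0 h => foldr (A_OBD_step delta) x0 h.

Definition admissible (R : realType) (M L G alpha : R) (A : algorithm R) :
    set (input R) :=
  [set s | I01 R (start s) /\
    forall t, (1 <= t <= horizon s)%N ->
      [/\ convex_function (I01 R : set R^o) (cost s t : R^o -> R^o),
          smooth M (cost s t),
          L.-lipschitz_(I01 R) (cost s t) &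
          min_zero (cost s t)] /\
      [/\ `|noise s t| <= alpha,
          `|avl_grad A s t| <= G &
          alpha < `|true_grad A s t|]].

Definition a_hat (R : realType) (L G alpha : R) : R :=
  (L - alpha * L / (G + L - 2 * alpha)) * (1 - alpha / (G + L - alpha)).

Definition b_hat (R : realType) (M L G alpha : R) : R :=
  (G + L + M / 2 + alpha * L / (G + L)) * (1 + alpha / (G + L - alpha)).

Definition ratio_bound (R : realType) (M L G alpha : R) : R :=
  Num.max (1 + (2 + b_hat M L G alpha) / a_hat L G alpha)
          (1 + b_hat M L G alpha).

(* Main.v *)
(* Every step has length m = f_t(x_{t-1}) / (G + L) and goes towards the
   minimizers of f_t, because alpha < |grad f_t(x_{t-1})| forces the received
   gradient to have the right sign.  The step does not pass a minimizer, since
   |grad f_t| <= L puts all of them at distance at least f_t(x_{t-1}) / L.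
   Hence f_t(x_t) <= f_t(x_{t-1}) = (G + L) m <= b_hat m, and the subgradient
   inequality gives f_t(x_t) >= (G + L - |grad f_t|) m >= max(G, L - alpha) m
   >= a_hat m.  Against a comparator y, use
   the potential (1 + b_hat) |x_t - y_t|: if f_t(y_t) < f_t(x_t), then y_t lies
   beyond x_t and the potential pays for the round; otherwise the hitting cost
   f_t(y_t) >= f_t(x_t) >= a_hat m pays. *)
Require Import Defs.
From HB Require Import structures.
From mathcomp Require Import all_boot all_order all_algebra.
From mathcomp Require Import all_classical all_reals all_analysis.
From mathcomp Require Import ring lra.
Import Order.TTheory GRing.Theory Num.Theory.
Import numFieldNormedType.Exports.
Local Open Scope classical_set_scope.
Local Open Scope ring_scope.

(** * Derivatives relative to the unit interval, and convexity *)

Lemma I01P (R : realType) (x : R) : I01 R x <-> 0 <= x <= 1.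
Proof. by rewrite /I01 /= in_itv. Qed.

Lemma I01_segment (R : realType) (x y t : R) :
  I01 R x -> I01 R y -> 0 <= t <= 1 -> I01 R (x + t * (y - x)).
Proof.
rewrite !I01P => /andP[x0 x1] /andP[y0 y1] /andP[t0 t1].
by apply/andP; split; nra.
Qed.

(** As [t] tends to 0 from the right, [x + t * (y - x)] tends to [x] within [[0,1]], avoiding [x]
    itself when [y != x]. So the relative derivative can be read along segments, at endpoints and
    interior points alike. *)
Lemma grad_directional (R : realType) (f : R -> R) (x y : R) :
  differentiable01 f -> I01 R x -> I01 R y ->
  (f (x + t * (y - x)) - f x) / t @[t --> 0^'+] --> grad f x * (y - x).
Proof.
move=> df xI yI; have [->|yx] := eqVneq y x.
  rewrite subrr mulr0; apply: cvg_near_cst; near=> t.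
  by rewrite mulr0 addr0 subrr mul0r.
have yx0 : y - x != 0 by rewrite subr_eq0.
have segment_cvg : x + t * (y - x) @[t --> 0^'+] --> within (I01 R) x^'.
  have to_x : x + t * (y - x) @[t --> (0 : R)^'+] --> x.
    rewrite -[X in _ --> X]addr0 -[X in _ --> _ + X](mul0r (y - x)).
    apply: cvgD; first exact: cvg_cst.
    by apply: cvgMl; apply: cvg_at_right_filter; exact: cvg_id.
  move=> U xU; rewrite /nbhs /=.
  have /to_x : nbhs x (fun z => z != x -> I01 R z -> U z) by exact: xU.
  rewrite /nbhs /= => nearU; near=> t.
  have t0 : 0 < t by near: t; exact: nbhs_right_gt.
  have t1 : t <= 1 by near: t; exact: nbhs_right_le.
  have moved : x + t * (y - x) != x.
    by rewrite -subr_eq0 addrAC subrr add0r mulf_neq0// gt_eqF.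
  have inside : I01 R (x + t * (y - x)) by apply: I01_segment; rewrite ?(ltW t0).
  move: moved inside; near: t; exact: nearU.
have : (f (x + t * (y - x)) - f x) / (x + t * (y - x) - x) @[t --> 0^'+]
    --> grad f x by apply: cvg_trans (df x xI); exact: cvg_app segment_cvg.
move=> /cvgMl => /(_ (y - x)); apply: cvg_trans; apply: near_eq_cvg; near=> t.
have t0 : 0 < t by near: t; exact: nbhs_right_gt.
have -> : x + t * (y - x) - x = t * (y - x) by ring.
by field; rewrite yx0 gt_eqF.
Unshelve. all: by end_near. Qed.

Lemma convex_I01 (R : realType) (f : R -> R) (x y t : R) :
  convex_function (I01 R : set R^o) (f : R^o -> R^o) ->
  I01 R x -> I01 R y -> 0 <= t <= 1 ->
  f (x + t * (y - x)) <= f x + t * (f y - f x).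
Proof.
move=> cf xI yI /andP[t0 t1].
have : f (t * y + (1 - t) * x) <= t * f y + (1 - t) * f x.
  exact: cf (Itv01 t0 t1) y x (mem_set yI) (mem_set xI).
have -> : t * y + (1 - t) * x = x + t * (y - x) by ring.
by have -> : t * f y + (1 - t) * f x = f x + t * (f y - f x) by ring.
Qed.

Lemma convex_between (R : realType) (f : R -> R) (x y z : R) :
  convex_function (I01 R : set R^o) (f : R^o -> R^o) ->
  I01 R x -> I01 R z -> x <= y <= z -> f y <= Num.max (f x) (f z).
Proof.
move=> cf xI zI /andP[xy yz].
have [xz|xz] := eqVneq x z.
  by have -> : y = x; [lra | rewrite le_max lexx].
have xz0 : 0 < z - x by rewrite subr_gt0 lt_neqAle xz (le_trans xy).
pose t := (y - x) / (z - x).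
have t01 : 0 <= t <= 1.
  by rewrite /t divr_ge0 ?(ltW xz0) ?subr_ge0//= ler_pdivrMr// mul1r lerD2r.
have -> : y = x + t * (z - x) by rewrite /t; field; rewrite gt_eqF.
have := @convex_I01 R f x z t cf xI zI t01 => /le_trans; apply.
move: t01 => /andP[t0 t1].
have : f x <= Num.max (f x) (f z) by rewrite le_max lexx.
have : f z <= Num.max (f x) (f z) by rewrite le_max lexx orbT.
by move: (Num.max _ _) => m; nra.
Qed.

Lemma subgradient (R : realType) (f : R -> R) (x y : R) :
  convex_function (I01 R : set R^o) (f : R^o -> R^o) -> differentiable01 f ->
  I01 R x -> I01 R y -> grad f x * (y - x) <= f y - f x.
Proof.
move=> cf df xI yI; apply: (cvgr_to_le (grad_directional R f x y df xI yI)).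
near=> t.
have t0 : 0 < t by near: t; exact: nbhs_right_gt.
have t1 : t <= 1 by near: t; exact: nbhs_right_le.
rewrite ler_pdivrMr// lerBlDl (mulrC _ t); apply: convex_I01 => //.
by rewrite (ltW t0).
Unshelve. all: by end_near. Qed.

Lemma normr_grad_le (R : realType) (f : R -> R) (L x : R) :
  L.-lipschitz_(I01 R) f -> differentiable01 f -> I01 R x -> `|grad f x| <= L.
Proof.
move=> lf df xI.
have [y [yI yx]] : exists y, I01 R y /\ y != x.
  have [->|x0] := eqVneq x 0.
    by exists 1; rewrite oner_neq0 I01P ler01 lexx.
  by exists 0; rewrite eq_sym x0 I01P ler01 lexx.
have yx0 : 0 < `|y - x| by rewrite normr_gt0 subr_eq0.
rewrite -(ler_pM2r yx0) -normrM.
apply: (cvgr_to_le (cvg_norm (grad_directional R f x y df xI yI))).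
near=> t.
have t0 : 0 < t by near: t; exact: nbhs_right_gt.
have t1 : t <= 1 by near: t; exact: nbhs_right_le.
rewrite normrM normfV (gtr0_norm t0) ler_pdivrMr//.
have /lf /= : (I01 R `*` I01 R) (x + t * (y - x), x).
  by split => //=; apply: I01_segment; rewrite ?(ltW t0).
have -> : x + t * (y - x) - x = t * (y - x) by ring.
by rewrite normrM (gtr0_norm t0) (mulrC t `|_|) mulrA.
Unshelve. all: by end_near. Qed.

(** * The explicit form of a step *)

(** [A_OBD] replays the whole history from the starting point. That the replay ends at the action
    stored by [run] turns the fold into a one-step recursion. *)
Lemma run_A_OBD (R : realType) (delta : R -> R) (s : input R) (t : nat) :
  (run (A_OBD delta) s t).1 = A_OBD delta (start s) (run (A_OBD delta) s t).2.
Proof. by case: t => //= t; case: (run _ s t). Qed.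

Lemma action_A_OBD (R : realType) (delta : R -> R) (s : input R) (t : nat) :
  let A := A_OBD delta in
  action A s t.+1 =
  A_OBD_step delta (cost s t.+1 (action A s t), avl_grad A s t.+1) (action A s t).
Proof.
rewrite /avl_grad /true_grad /action /= {1 2}/A_OBD.
by have := run_A_OBD R delta s t; case: (run _ s t) => /= x h ->.
Qed.

(** Since [g = Num.sg g * |g|], collecting slopes in [L1 y = L2 y] cancels [|g|] and leaves
    [Num.sg g * S * (y - x) = - v], an equation with a single solution. *)
Lemma A_OBD_stepE (R : realType) (S v g x : R) :
  0 < S -> g != 0 ->
  A_OBD_step (fun g => S - `|g|) (v, g) x = x - Num.sg g * (v / S).
Proof.
move=> S0 g0 /=.
have SV : S != 0 by rewrite gt_eqF.
apply: xget_unique => /= [|y].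
  case: (ltgtP g 0) g0 => [g0 _|g0 _|-> /eqP//].
    rewrite (ltr0_norm g0) (ltr0_sg g0) gtr0_sg ?oppr_gt0//; by field.
  rewrite (gtr0_norm g0) (gtr0_sg g0) ltr0_sg ?oppr_lt0//; by field.
case: (ltgtP g 0) g0 => [g0 _|g0 _|-> /eqP//].
  rewrite (ltr0_norm g0) (ltr0_sg g0) gtr0_sg ?oppr_gt0// => e.
  by apply: (mulfI SV); rewrite mulrBr mulN1r mulrN mulrCA divff// mulr1; lra.
rewrite (gtr0_norm g0) (gtr0_sg g0) ltr0_sg ?oppr_lt0// => e.
by apply: (mulfI SV); rewrite mulrBr mul1r mulrCA divff// mulr1; lra.
Qed.

(** At a minimizer [m] the subgradient inequality reads [f x <= grad f x * (x - m)]. As [f x >= 0],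
    this fixes the side of [m], and [|grad f x| <= L <= S] gives the distance. *)
Lemma minimizer_far (R : realType) (f : R -> R) (L S x : R) :
  convex_function (I01 R : set R^o) (f : R^o -> R^o) -> differentiable01 f ->
  L.-lipschitz_(I01 R) f -> min_zero f -> I01 R x ->
  0 < L -> L <= S -> grad f x != 0 ->
  exists m, [/\ I01 R m, f m = 0 & f x / S <= Num.sg (grad f x) * (x - m)].
Proof.
move=> cf df lf [f0 [m [mI fm]]] xI L0 LS g0; exists m; split => //.
have := subgradient _ f x m cf df xI mI; rewrite fm => sub.
have := normr_grad_le _ f L x lf df xI => gL.
have fx0 := f0 x xI.
rewrite ler_pdivrMr; last lra.
case: (ltgtP (grad f x) 0) g0 gL => [g0 _|g0 _|-> /eqP//].
  rewrite (ltr0_norm g0) (ltr0_sg g0); nra.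
rewrite (gtr0_norm g0) (gtr0_sg g0); nra.
Qed.

(** The new point lies between [x] and [m]. If [z] were on its [x] side, it would lie between [m]
    and [z], and convexity with [f m = 0] would bound its value by [f z]. So a better [z] lies
    strictly beyond it, and distances subtract. *)
Lemma step_toward_minimizer (R : realType) (f : R -> R) (s d x m : R) :
  convex_function (I01 R : set R^o) (f : R^o -> R^o) -> min_zero f ->
  I01 R x -> I01 R m -> f m = 0 -> (s == 1) || (s == -1) ->
  0 <= d <= s * (x - m) ->
  [/\ I01 R (x - s * d), f (x - s * d) <= f x &
      forall z, I01 R z -> f z < f (x - s * d) ->
        `|x - s * d - z| = `|x - z| - d].
Proof.
move=> cf [f0 _] xI mI fm s1 /andP[d0 dm].
have between z : I01 R z -> 0 <= s * (z - (x - s * d)) ->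
    f (x - s * d) <= f z.
  move=> zI; have fz0 := f0 z zI.
  have -> : f z = Num.max (f z) (f m) by rewrite fm; apply/esym/max_idPl.
  case/orP: s1 dm => /eqP -> dm zx.
    by rewrite maxC; apply: convex_between => //; lra.
  by apply: convex_between => //; lra.
have s2 : s * s = 1 by case/orP: s1 => /eqP ->; rewrite ?mulrNN mulr1.
split.
- move: xI mI; rewrite !I01P => /andP[x0 x1] /andP[m0 m1].
  by case/orP: s1 dm => /eqP -> dm; apply/andP; split; lra.
- by apply: between => //; rewrite opprB addrCA subrr addr0 mulrA s2 mul1r.
- move=> z zI; rewrite ltNge => /negP fz.
  have : ~ 0 <= s * (z - (x - s * d)) by move=> /(between z zI).
  move=> /negP; rewrite -ltNge.
  case/orP: s1 => /eqP -> zx.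
    rewrite !gtr0_norm; lra.
  rewrite !ltr0_norm; lra.
Qed.

(** * Estimates for the two constants *)

(* At [G + L = 2 * alpha] the junk value [x / 0 = 0] makes the first factor of
   [a_hat] equal to [L], but the second factor vanishes. *)
Lemma a_hatE (R : realType) (L G alpha : R) :
  0 < L -> 0 < G -> alpha < L -> 0 < a_hat L G alpha ->
  3 * alpha < G + L /\
  a_hat L G alpha = L * (G + L - 3 * alpha) / (G + L - alpha).
Proof.
move=> L0 G0 aL; rewrite /a_hat.
have S1 : 0 < G + L - alpha by lra.
have [S2|S2] := eqVneq (G + L - 2 * alpha) 0.
  have -> : alpha / (G + L - alpha) = 1.
    have e : G + L - alpha = alpha by lra.
    by rewrite e divff // gt_eqF // -e.
  by rewrite subrr mulr0 ltxx.
have -> : (L - alpha * L / (G + L - 2 * alpha)) * (1 - alpha / (G + L - alpha))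
    = L * (G + L - 3 * alpha) / (G + L - alpha).
  by field; rewrite S2 gt_eqF.
move=> h; split => //; move: h.
by rewrite pmulr_lgt0 ?invr_gt0// pmulr_rgt0// subr_gt0.
Qed.

(** The gradient is at most [L] and at most [G + alpha] in absolute value, so the maximum bounds
    [G + L - |grad f x|] from below. After cross-multiplication, the case [G <= L - alpha] has slack
    [alpha * (L - G + alpha)]. *)
Lemma a_hat_le (R : realType) (L G alpha : R) :
  0 < L -> 0 < G -> 0 <= alpha -> alpha < L -> 0 < a_hat L G alpha ->
  a_hat L G alpha <= Num.max G (L - alpha).
Proof.
move=> L0 G0 a0 aL /(a_hatE R L G alpha L0 G0 aL) [S3 ->].
have S1 : 0 < G + L - alpha by lra.
rewrite ler_pdivrMr//; have [GL|GL] := leP G (L - alpha); nra.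
Qed.

Lemma b_hat_ge (R : realType) (M L G alpha : R) :
  0 <= M -> 0 < L -> 0 < G -> 0 <= alpha -> alpha < L ->
  G + L <= b_hat M L G alpha.
Proof.
move=> M0 L0 G0 a0 aL; rewrite /b_hat.
have p : 0 <= alpha * L / (G + L) by rewrite divr_ge0 ?mulr_ge0//; lra.
have q : 0 <= alpha / (G + L - alpha) by rewrite divr_ge0//; lra.
by move: (alpha * L / _) (alpha / _) p q => u v u0 v0; nra.
Qed.

(** * The potential argument *)

(** Write [m] for [|y - x|]. If [fz < fy], the step lowers the potential by [(1 + b) * m >= fy + m].
    Otherwise it raises it by at most [(1 + b) * m], and [fy + (2 + b) * m <= (1 + (2 + b) / a) * fy
    <= rho * fz]. The comparator's own move costs [1 + b <= rho] per unit in both cases. *)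
Lemma amortized_round (R : realType) (a b rho x y z z' fy fz : R) :
  0 < a -> 0 <= b -> 1 + (2 + b) / a <= rho -> 1 + b <= rho -> 0 <= fz ->
  a * `|y - x| <= fy <= b * `|y - x| ->
  (fz < fy -> `|y - z| = `|x - z| - `|y - x|) ->
  fy + `|y - x| + (1 + b) * `|y - z| <=
  rho * (fz + `|z - z'|) + (1 + b) * `|x - z'|.
Proof.
move=> a0 b0 + rb fz0 /andP[af fb] toward.
have := ler_distD z' x z; rewrite (distrC z').
have : 0 <= `|z - z'| by [].
case: (ltP fz fy) => [/toward ->|fyz].
  by move: `|y - x| `|x - z| `|x - z'| `|z - z'| fb => m p q r; nra.
have := ler_distD x y z; have : 0 <= `|y - x| by [].
set k := (2 + b) / a; have : k * a = 2 + b by rewrite /k divfK ?gt_eqF.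
have : 0 <= k by rewrite /k divr_ge0 ?(ltW a0)// addr_ge0.
move: k `|y - x| `|x - z| `|y - z| `|x - z'| `|z - z'| af fb.
move=> k m p q r w af fb k0 ka m0 qm w0 pr rk.
have fy0 : 0 <= fy by apply: le_trans af; rewrite mulr_ge0// ltW.
have kf : (2 + b) * m <= k * fy by rewrite -ka -mulrA ler_wpM2l.
have : (1 + k) * fy <= rho * fz by apply: ler_pM => //; lra.
have : (1 + b) * w <= rho * w by rewrite ler_wpM2r.
have : (1 + b) * q <= (1 + b) * (m + r + w) by rewrite ler_wpM2l; lra.
lra.
Qed.

Lemma A_OBD_round (R : realType) (M L G alpha : R) (f : R -> R) (x n : R) :
  0 <= M -> 0 < L -> 0 < G -> 0 <= alpha -> 0 < a_hat L G alpha ->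
  convex_function (I01 R : set R^o) (f : R^o -> R^o) -> differentiable01 f ->
  L.-lipschitz_(I01 R) f -> min_zero f -> I01 R x ->
  `|n| <= alpha -> `|grad f x + n| <= G -> alpha < `|grad f x| ->
  let y := A_OBD_step (fun g => G + L - `|g|) (f x, grad f x + n) x in
  [/\ I01 R y,
      a_hat L G alpha * `|y - x| <= f y <= b_hat M L G alpha * `|y - x| &
      forall z, I01 R z -> f z < f y -> `|y - z| = `|x - z| - `|y - x|].
Proof.
move=> M0 L0 G0 a0 ah0 cf df lf mf xI na gG ag.
have gL := normr_grad_le _ f L x lf df xI.
have aL : alpha < L by exact: lt_le_trans gL.
have S0 : 0 < G + L by exact: addr_gt0.
have g0 : grad f x != 0 by rewrite -normr_gt0; exact: le_lt_trans ag.
(* The noise is smaller than the gradient in absolute value, so it cannot change its sign. *)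
have [sgE gaG gn0] : [/\ Num.sg (grad f x + n) = Num.sg (grad f x),
    `|grad f x| <= G + alpha & grad f x + n != 0].
  move: na gG ag; rewrite !ler_norml => /andP[n1 n2] /andP[g1 g2].
  case: (ltgtP (grad f x) 0) g0 => [g0 _|g0 _|-> /eqP//].
    rewrite ltr0_norm// => ag; have gn : grad f x + n < 0 by lra.
    by rewrite !ltr0_sg// lt_eqF//; split=> //; lra.
  rewrite gtr0_norm// => ag; have gn : 0 < grad f x + n by lra.
  by rewrite !gtr0_sg// gt_eqF//; split=> //; lra.
have LS : L <= G + L by lra.
have [m [mI fm xm]] := minimizer_far _ f L (G + L) x cf df lf mf xI L0 LS g0.
have fx0 : 0 <= f x by case: mf => + _; apply.
rewrite A_OBD_stepE// sgE; move: xm.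
set s := Num.sg (grad f x); set d := f x / (G + L) => xm y.
have d0 : 0 <= d by rewrite divr_ge0// ltW.
have fxE : f x = (G + L) * d by rewrite /d mulrC divfK// gt_eqF.
have s1 : (s == 1) || (s == -1).
  rewrite /s; case: (ltgtP (grad f x) 0) g0 => [g0 _|g0 _|-> /eqP//].
    by rewrite ltr0_sg// eqxx orbT.
  by rewrite gtr0_sg// eqxx.
have dm : 0 <= d <= s * (x - m) by rewrite d0.
have [yI fyx toward] := step_toward_minimizer _ f s d x m cf mf xI mI fm s1 dm.
have yxE : `|y - x| = d.
  rewrite /y addrAC subrr add0r normrN normrM (ger0_norm d0).
  by case/orP: s1 => /eqP ->; rewrite ?normrN normr1 mul1r.
rewrite yxE; split => //; apply/andP; split; last first.
  apply: (le_trans fyx); rewrite fxE ler_wpM2r//; exact: b_hat_ge.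
(* The step goes against the gradient, so the linear term is [- |grad f x| * d]; with
   [f x = (G + L) * d] this bounds [f y] from below. *)
have := subgradient _ f x y cf df xI yI.
have -> : grad f x * (y - x) = - (`|grad f x| * d).
  by rewrite /y addrAC subrr add0r mulrN mulrA normrEsg (mulrC (Num.sg _)).
rewrite fxE => fy; have := a_hat_le _ L G alpha L0 G0 a0 aL ah0.
move=> ah; apply: (@le_trans _ _ ((G + L - `|grad f x|) * d)); last lra.
rewrite ler_wpM2r//; apply: (le_trans ah).
by rewrite ge_max; apply/andP; split; lra.
Qed.

Lemma total_cost_potential (R : realType) (s : input R) (x y : nat -> R)
    (c rho : R) :
  0 <= c -> x 0%N = y 0%N ->
  (forall t, (t < horizon s)%N ->
    cost s t.+1 (x t.+1) + `|x t.+1 - x t| + c * `|x t.+1 - y t.+1| <=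
    rho * (cost s t.+1 (y t.+1) + `|y t.+1 - y t|) + c * `|x t - y t|) ->
  total_cost s x <= rho * total_cost s y.
Proof.
move=> c0 xy0 round; rewrite /total_cost.
pose cst u n := \sum_(1 <= t < n.+1) (cost s t (u t) + `|u t - u t.-1|).
suff potential n : (n <= horizon s)%N ->
    cst x n + c * `|x n - y n| <= rho * cst y n.
  by apply: le_trans (potential _ (leqnn _)); rewrite lerDl mulr_ge0.
elim: n => [_|n IHn nT].
  by rewrite /cst !big_geq// xy0 subrr normr0 !mulr0 addr0.
have := round n nT; have := IHn (ltnW nT).
rewrite /cst !(big_nat_recr n.+1)//= mulrDr.
lra.
Qed.

Lemma A_OBD_competitive (R : realType) (M L G alpha : R) :
  0 <= M -> 0 < L -> 0 < G -> 0 <= alpha -> 0 < a_hat L G alpha ->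
  let A := A_OBD (fun g : R => G + L - `|g|) in
  competitive_ratio_le A (admissible M L G alpha A) (ratio_bound M L G alpha).
Proof.
move=> M0 L0 G0 a0 ah0 A s [x0I adm].
have round t : (t < horizon s)%N -> I01 R (action A s t) ->
    let f := cost s t.+1 in
    let x := action A s t in let y := action A s t.+1 in
    [/\ I01 R y,
      a_hat L G alpha * `|y - x| <= f y <= b_hat M L G alpha * `|y - x| &
      forall z, I01 R z -> f z < f y -> `|y - z| = `|x - z| - `|y - x|].
  move=> tT xI /=; have [[cf [df _] lf mf] [na gG ag]] := adm t.+1 tT.
  by rewrite action_A_OBD; apply: A_OBD_round.
have actionI t : (t <= horizon s)%N -> I01 R (action A s t).
  by elim: t => // t IHt tT; case: (round t tT (IHt (ltnW tT))).
split; first by split=> // t /andP[_]; exact: actionI.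
(* The inequality [alpha < L], hence the sign of the bound, is obtained from round 1. Without rounds
   all costs are 0. *)
have [T0|T0] := posnP (horizon s).
  have cost0 u : total_cost s u = 0 by rewrite /total_cost T0 big_geq.
  rewrite cost0 /opt_cost.
  suff -> : [set total_cost s x | x in feasible s] = [set 0].
    by rewrite inf1 mulr0.
  apply/seteqP; split=> [_ [u _ <-]|_ ->]; first by rewrite /= cost0.
  exists (fun=> start s); last by rewrite cost0.
  by split=> // t; rewrite T0; case: t.
have aL : alpha < L.
  have [[cf [df _] lf mf] [na gG ag]] := adm 1%N T0.
  exact: lt_le_trans ag (normr_grad_le _ _ L _ lf df (actionI 0%N _)).
have bh := b_hat_ge _ M L G alpha M0 L0 G0 a0 aL.
have bh0 : 0 <= b_hat M L G alpha by lra.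
have rho0 : 0 < ratio_bound M L G alpha.
  by rewrite /ratio_bound lt_max; apply/orP; right; lra.
(* Dividing by the positive ratio turns the claim into a lower bound on the infimum, checked against
   each feasible comparator. *)
rewrite -ler_pdivrMl//; apply: lb_le_inf.
  by exists (total_cost s (fun=> start s)); exists (fun=> start s).
move=> _ [z [z0 zI] <-]; rewrite ler_pdivrMl//.
apply: (@total_cost_potential _ _ _ _ (1 + b_hat M L G alpha)).
- by rewrite addr_ge0.
- by rewrite z0.
- move=> t tT; have [yI fy toward] := round t tT (actionI t (ltnW tT)).
  have [[_ _ _ [f0 _]] _] := adm t.+1 tT.
  apply: amortized_round fy _ => //.
  + by rewrite /ratio_bound le_max lexx.
  + by rewrite /ratio_bound le_max lexx orbT.
  + exact/f0/zI.
  + by apply: toward; exact: zI.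
Qed.

(** * The asymptotic form of the bound *)

Lemma b_hat_le (R : realType) (M L G alpha : R) :
  0 <= M -> 0 < L -> 0 < G -> 0 <= alpha -> alpha < L ->
  3 * alpha < G + L ->
  b_hat M L G alpha <= 3 * (G + M + L).
Proof.
move=> M0 L0 G0 a0 aL S3; rewrite /b_hat.
have p : alpha * L / (G + L) <= L.
  rewrite ler_pdivrMr; [nra|lra].
have q0 : 0 <= alpha / (G + L - alpha) by rewrite divr_ge0//; lra.
have q : alpha / (G + L - alpha) <= 1 / 2.
  rewrite ler_pdivrMr; lra.
have p0 : 0 <= alpha * L / (G + L) by rewrite divr_ge0 ?mulr_ge0//; lra.
move: (alpha * L / _) (alpha / _) p q p0 q0 => u v u1 v1 u0 v0.
apply: (@le_trans _ _ ((G + M / 2 + 2 * L) * (3 / 2))); last lra.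
by apply: ler_pM; lra.
Qed.

(** With [G] and [eps] fixed, [eps <= a_hat <= L] gives [1 <= K * L], so constants are absorbed into
    multiples of [M + L], and [1 / a_hat] is at most [K]. *)
Lemma ratio_bound_bigO (R : realType) (G eps : R) : 0 < G -> 0 < eps ->
  exists C : R, 0 < C /\
    forall M L alpha : R,
      0 < M -> 0 < L -> 0 <= alpha -> alpha < L ->
      eps <= a_hat L G alpha ->
      `|ratio_bound M L G alpha| <= C * (M + L + alpha ^+ 2).
Proof.
move=> G0 e0; pose K := eps^-1; pose B := 3 * (G * K + 1).
have K0 : 0 < K by rewrite invr_gt0.
have B0 : 0 < B by rewrite /B; nra.
(* The three summands bound, as multiples of [M + L], the terms [1], [b_hat] and
   [(2 + b_hat) / a_hat]; [B] comes from [b_hat <= 3 * (G + M + L)]. *)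
exists (K + B + (2 * K + B) * K); split; first nra.
move=> M L alpha M0 L0 a0 aL ea.
have ah0 := lt_le_trans e0 ea.
have [S3 aE] := a_hatE _ L G alpha L0 G0 aL ah0.
have eL : eps <= L.
  apply: (le_trans ea); rewrite aE ler_pdivrMr; [nra|lra].
have KL : 1 <= K * L by rewrite /K mulrC ler_pdivlMr// mul1r.
have := b_hat_ge _ M L G alpha (ltW M0) L0 G0 a0 aL.
have := b_hat_le _ M L G alpha (ltW M0) L0 G0 a0 aL S3.
rewrite /ratio_bound; move: (b_hat _ _ _ _) => b b_le b_ge.
have one_le : 1 <= K * (M + L) by nra.
have G_le : G * 1 <= G * (K * (M + L)) by rewrite ler_wpM2l// ltW.
have b_leB : b <= B * (M + L) by apply: (le_trans b_le); rewrite /B; lra.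
have iaK : (a_hat L G alpha)^-1 <= K by rewrite lef_pV2.
have ia0 : 0 < (a_hat L G alpha)^-1 by rewrite invr_gt0.
move: (a_hat L G alpha)^-1 ia0 iaK => i i0 iK.
have b0 : 0 <= b by lra.
have bi : (2 + b) * i <= (2 * K + B) * (M + L) * K.
  by apply: ler_pM => //; lra.
have sq : 0 <= (K + B + (2 * K + B) * K) * alpha ^+ 2.
  by rewrite mulr_ge0 ?sqr_ge0//; nra.
have bi0 : 0 <= (2 + b) * i by rewrite mulr_ge0//; lra.
have KK : 0 <= (2 * K + B) * (M + L) * K.
  exact: le_trans bi.
have BB : 0 <= B * (M + L) by exact: le_trans b_leB.
rewrite ger0_norm; last by rewrite le_max; apply/orP; right; lra.
by rewrite ge_max; apply/andP; split; lra.
Qed.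

Theorem theorem4 (R : realType) :
  (forall M L G alpha : R,
     0 < M -> 0 < L -> 0 < G -> 0 <= alpha ->
     0 < a_hat L G alpha ->
     let A := A_OBD (fun g : R => G + L - `|g|) in
     competitive_ratio_le A (admissible M L G alpha A)
       (ratio_bound M L G alpha))
  /\
  (forall G eps : R, 0 < G -> 0 < eps ->
     exists C : R, 0 < C /\
       forall M L alpha : R,
         0 < M -> 0 < L -> 0 <= alpha -> alpha < L ->
         eps <= a_hat L G alpha ->
         `|ratio_bound M L G alpha| <= C * (M + L + alpha ^+ 2)).
Proof.
split; last by move=> G eps; exact: ratio_bound_bigO.
by move=> M L G alpha /ltW; exact: A_OBD_competitive.
Qed.
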